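(* Let $V,W,g,\mu,\gamma,\Phi,\mathcal{L},\mathcal{L}^*$ be as in the context. Assume that there exists a simple isolated eigenvalue $\lambda_0\in\mathbb{C}\setminus\{0\}$ of the spectral problem $\mathcal{L}v=-i\lambda\sigma_3v$ and of the adjoint spectral problem $\mathcal{L}^*v^\#=-i\lambda\sigma_3v^\#$, with eigenvector $v_0=(Y,Z)\in D(L_0)\times D(L_0)$ and adjoint eigenvector $v_0^\#=(Y^\#,Z^\#)\in D(L_0)\times D(L_0)$, respectively. Define the Krein quantity $$K(\lambda_0)=\langle v_0,\sigma_3v_0^\#\rangle=\int_{\mathbb{R}}\Big[Y(x)\overline{Y^\#(x)}-Z(x)\overline{Z^\#(x)}\Big]dx .$$ Then: (1) $K(\lambda_0)$ is real if $\lambda_0\in i\mathbb{R}\setminus\{0\}$; (2) $K(\lambda_0)\neq0$ if $\lambda_0\in i\mathbb{R}\setminus\{0\}$; (3) $K(\lambda_0)=0$ if $\lambda_0\in\mathbb{C}\setminus i\mathbb{R}$.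
   Context: Setting. $V,W:\mathbb{R}\to\mathbb{R}$ satisfy $V(-x)=V(x)$, $W(-x)=-W(x)$; $g\in\{+1,-1\}$; $\mu\in\mathbb{R}$ is fixed. (A1) The operator $L_0=-\partial_x^2+V(x)$ in $L^2(\mathbb{R})$ admits a self-adjoint extension with a dense domain $D(L_0)$ in $L^2(\mathbb{R})$. (A2) $W$ is bounded and $|W(x)|\le Ce^{-\kappa|x|}$ for all $x\in\mathbb{R}$, for some $C,\kappa>0$. (A3) There is $\gamma_*>0$ such that for $\gamma\in(-\gamma_*,\gamma_* )$ there is a bounded, decaying solution $\Phi=\Phi(\gamma)\in D(L_0)\subset L^2(\mathbb{R})$ of $$-\Phi''+(V+i\gamma W)\Phi-g|\Phi|^2\Phi=\mu\Phi,$$ with $\Phi(x)=\overline{\Phi(-x)}$ and $|\Phi(x)|\le Ce^{-\kappa|x|}$ for all $x\in\mathbb{R}$, for some $C,\kappa>0$; moreover $\gamma\mapsto\Phi\in D(L_0)$ is real-analytic on $(-\gamma_*,\gamma_* )$. Fix $\gamma\in(-\gamma_*,\gamma_* )$. Operators. With $\sigma_3=\mathrm{diag}(1,-1)$, define on $D(L_0)\times D(L_0)\subset L^2(\mathbb{R})\times L^2(\mathbb{R})$ $$\mathcal{L}=\begin{bmatrix} -\partial_x^2+V+i\gamma W-\mu-2g|\Phi|^2 & -g\Phi^2\\ -g\overline{\Phi}^2 & -\partial_x^2+V-i\gamma W-\mu-2g|\Phi|^2\end{bmatrix},$$ $$\mathcal{L}^*=\begin{bmatrix} -\partial_x^2+V-i\gamma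 W-\mu-2g|\Phi|^2 & -g\Phi^2\\ -g\overline{\Phi}^2 & -\partial_x^2+V+i\gamma W-\mu-2g|\Phi|^2\end{bmatrix}.$$ $\lambda\in\mathbb{C}$ is an eigenvalue of the spectral problem $\mathcal{L}v=-i\lambda\sigma_3v$ if there is a nonzero solution $v\in D(L_0)\times D(L_0)$; equivalently, $\lambda$ is an eigenvalue of $i\sigma_3\mathcal{L}$. Isolated means an isolated point of the spectrum of $i\sigma_3\mathcal{L}$; simple means algebraic multiplicity one. The same conventions apply to the adjoint problem. Inner product: $\langle (f_1,f_2),(h_1,h_2)\rangle=\int_{\mathbb{R}}(f_1\overline{h_1}+f_2\overline{h_2})\,dx$. Normalization. If $\lambda_0\in i\mathbb{R}\setminus\{0\}$, the vectors $v_0$ and $v_0^\#$ are normalized to be $\mathcal{PT}$-symmetric, i.e. each component $f\in\{Y,Z,Y^\#,Z^\#\}$ satisfies $f(x)=\overline{f(-x)}$ for $x\in\mathbb{R}$. *)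

(* Defs.v *)
From HB Require Import structures.
From mathcomp Require Import all_boot all_order all_algebra.
From mathcomp Require Import complex.
From mathcomp Require Import all_classical all_reals all_analysis.

Set Implicit Arguments.
Unset Strict Implicit.
Unset Printing Implicit Defensive.

Import Order.TTheory GRing.Theory Num.Theory.
Import numFieldNormedType.Exports.

Local Open Scope classical_set_scope.
Local Open Scope ring_scope.
Local Open Scope complex_scope.

(* Elements of L^2(R; C) are represented by Borel functions, and equality in
   L^2 is equality almost everywhere.                                          *)

Notation cfun R := (R -> R[i]) (only parsing).
Notation cfun2 R := ((R -> R[i]) * (R -> R[i]))%type (only parsing).

Section L2.
Context {R : realType}.
Implicit Types f h : cfun R.

Definition cabs (z : R[i]) : R := complex.Re `|z|.

Definition cmeasurable f : Prop :=
  measurable_fun [set: R] (fun x => complex.Re (f x)) /\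
  measurable_fun [set: R] (fun x => complex.Im (f x)).

Definition cintegrable f : Prop :=
  cmeasurable f /\
  lebesgue_measure.-integrable [set: R] (fun x => (cabs (f x))%:E).

Definition cint (A : set R) f : R[i] :=
  (\int[lebesgue_measure]_(x in A) complex.Re (f x)) +i*
  (\int[lebesgue_measure]_(x in A) complex.Im (f x)).

Definition L2 f : Prop :=
  cmeasurable f /\
  lebesgue_measure.-integrable [set: R] (fun x => (cabs (f x) ^+ 2)%:E).

Definition aeq f h : Prop := ae_eq lebesgue_measure [set: R] f h.

Definition inner f h : R[i] := cint [set: R] (fun x => f x * conjc (h x)).

Definition sqnorm f : R := \int[lebesgue_measure]_x (cabs (f x) ^+ 2).

Implicit Types u v : cfun2 R.

Definition L2x2 u : Prop := L2 u.1 /\ L2 u.2.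

Definition aeq2 u v : Prop := aeq u.1 v.1 /\ aeq u.2 v.2.

Definition zero2 : cfun2 R := (fun=> 0, fun=> 0).

Definition inner2 u v : R[i] := inner u.1 v.1 + inner u.2 v.2.

Definition sqnorm2 u : R := sqnorm u.1 + sqnorm u.2.

Definition lincomb2 m (c : 'I_m -> R[i]) (e : 'I_m -> cfun2 R) : cfun2 R :=
  (fun x => \sum_(i < m) c i * (e i).1 x,
   fun x => \sum_(i < m) c i * (e i).2 x).

Definition has_dim (S : set (cfun2 R)) (m : nat) : Prop :=
  exists e : 'I_m -> cfun2 R,
    [/\ forall i, S (e i),
        forall c, aeq2 (lincomb2 c e) zero2 -> forall i, c i = 0
      & forall u, S u -> exists c, aeq2 u (lincomb2 c e)].

End L2.

(* An unbounded operator: the values of act outside dom are irrelevant.        *)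
Record operator (E : Type) := Operator { dom : set E ; act : E -> E }.

Section OperatorsL2.
Context {R : realType}.
Implicit Types A : operator (cfun R).

Definition L2_operator A : Prop :=
  [/\ forall u, dom A u -> L2 u /\ L2 (act A u),
      dom A (fun=> 0),
      forall u v, dom A u -> cmeasurable v -> aeq u v ->
        dom A v /\ aeq (act A u) (act A v)
    & forall (c : R[i]) u v, dom A u -> dom A v ->
        dom A (fun x => c * u x + v x) /\
        aeq (act A (fun x => c * u x + v x))
            (fun x => c * act A u x + act A v x)].

Definition dense_dom A : Prop :=
  forall f, L2 f -> forall eps : R, 0 < eps ->
    exists2 u, dom A u & sqnorm (fun x => f x - u x) < eps.

(* (f, h) lies in the graph of the Hilbert-space adjoint of A.                 *)
Definition adjoint_graph A (f h : cfun R) : Prop :=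
  [/\ L2 f, L2 h & forall u, dom A u -> inner (act A u) f = inner u h].

Definition self_adjoint A : Prop :=
  [/\ L2_operator A, dense_dom A
    & forall f h, L2 h ->
        (adjoint_graph A f h <-> dom A f /\ aeq (act A f) h)].

(* The graph of -d^2/dx^2 + V in L^2 on its minimal domain: phi has compact
   support, phi and phi' = phi1 are absolutely continuous, phi'' = phi2, and
   h = -phi'' + V phi is in L^2.  When V is in L^2_loc, this operator and its
   restriction to smooth compactly supported functions have the same
   self-adjoint extensions.                                                    *)
Definition min_schrodinger (V : R -> R) (phi h : cfun R) : Prop :=
  [/\ exists M : R, forall x, M < `|x| -> phi x = 0,
      exists phi1 phi2 : cfun R,
        [/\ cintegrable phi1, cintegrable phi2,
            forall x, phi x = cint `]-oo, x] phi1,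
            forall x, phi1 x = cint `]-oo, x] phi2
          & forall x, h x = - phi2 x + (V x)%:C * phi x]
    & L2 h].

Definition self_adjoint_extension (V : R -> R) A : Prop :=
  self_adjoint A /\
  forall phi h, min_schrodinger V phi h -> dom A phi /\ aeq (act A phi) h.

Definition graph_sqnorm A (u : cfun R) : R := sqnorm u + sqnorm (act A u).

(* Real-analyticity of a map from ]-b, b[ to dom A, the latter with its graph
   norm: local expansion in a convergent power series with coefficients in
   dom A.                                                                      *)
Definition real_analytic A (b : R) (F : R -> cfun R) : Prop :=
  forall t0, - b < t0 < b ->
  exists (a : nat -> cfun R) (r : R),
    [/\ 0 < r, forall n, dom A (a n)
      & forall t, - b < t < b -> `|t - t0| < r ->
          (fun n => graph_sqnorm A
             (fun x => F t x - \sum_(k < n) ((t - t0) ^+ k)%:C * a k x))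
          @ \oo --> (0 : R)].

End OperatorsL2.

Section Spectral.
Context {R : realType}.
Implicit Types (T : operator (cfun2 R)) (z : R[i]).

Definition shift T z (u : cfun2 R) : cfun2 R :=
  (fun x => (act T u).1 x - z * u.1 x, fun x => (act T u).2 x - z * u.2 x).

(* S is a bounded everywhere defined inverse of T - z on L^2 x L^2.            *)
Definition is_resolvent T z (S : cfun2 R -> cfun2 R) : Prop :=
  [/\ forall f, L2x2 f -> dom T (S f) /\ aeq2 (shift T z (S f)) f,
      forall u, dom T u -> aeq2 (shift T z u) zero2 -> aeq2 u zero2
    & exists M : R, forall f, L2x2 f -> sqnorm2 (S f) <= M * sqnorm2 f].

Definition spectrum T : set R[i] := [set z | ~ exists S, is_resolvent T z S].

Definition expi (t : R) : R[i] := cos t +i* sin t.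

(* P = - (2 pi i)^-1 \oint (T - z)^-1 dz, as a weak integral over the circle
   z = z0 + r e^{i t}, where dz = i r e^{i t} dt, and r is such that z0 is the
   only point of the closed disc that may be in the spectrum.                  *)
Definition is_riesz_projection T z0 (P : cfun2 R -> cfun2 R) : Prop :=
  exists (r : R) (Res : R[i] -> cfun2 R -> cfun2 R),
    [/\ 0 < r,
        forall z, 0 < cabs (z - z0) <= r -> is_resolvent T z (Res z),
        forall f, L2x2 f -> L2x2 (P f)
      & forall f h, L2x2 f -> L2x2 h ->
          inner2 (P f) h =
          - ((2 * pi)^-1)%:C *
          cint `[0, 2 * pi] (fun t =>
            inner2 (Res (z0 + r%:C * expi t) f) h * (r%:C * expi t))].

(* The algebraic multiplicity of an isolated point of the spectrum is the
   dimension of the range of its Riesz projection.                             *)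
Definition algebraic_multiplicity T z0 (m : nat) : Prop :=
  exists2 P, is_riesz_projection T z0 P & has_dim (P @` [set f | L2x2 f]) m.

Definition sigma3 (u : cfun2 R) : cfun2 R := (u.1, fun x => - u.2 x).

Definition isigma3 T : operator (cfun2 R) :=
  Operator (dom T)
    (fun u => (fun x => 'i%C * (act T u).1 x, fun x => - 'i%C * (act T u).2 x)).

(* v is an eigenvector of the problem T v = - i lambda sigma3 v.               *)
Definition krein_eigenvector T (lambda : R[i]) (v : cfun2 R) : Prop :=
  [/\ dom T v, ~ aeq2 v zero2
    & aeq2 (act T v) (fun x => - 'i%C * lambda * (sigma3 v).1 x,
                      fun x => - 'i%C * lambda * (sigma3 v).2 x)].

Definition krein_eigenvalue T (lambda : R[i]) : Prop :=
  exists v, krein_eigenvector T lambda v.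

Definition simple_isolated_eigenvalue T (lambda : R[i]) : Prop :=
  [/\ krein_eigenvalue T lambda,
      isolated (spectrum (isigma3 T) : set R[i]^o) lambda
    & algebraic_multiplicity (isigma3 T) lambda 1].

End Spectral.

Section PT.
Context {R : realType}.
Implicit Types (W : R -> R) (Phi : cfun R).

Definition exp_decay (f : cfun R) : Prop :=
  exists C kappa : R,
    [/\ 0 < C, 0 < kappa & forall x, cabs (f x) <= C * expR (- kappa * `|x|)].

Definition PT_symmetric (f : cfun R) : Prop := aeq f (fun x => conjc (f (- x))).

(* L0 Phi + i gamma W Phi - g |Phi|^2 Phi = mu Phi, where L0 realizes
   -d^2/dx^2 + V.  The pointwise bound entails that Phi is bounded and
   decaying.                                                                   *)
Definition stationary_state (L0 : operator (cfun R)) W (g mu gamma : R) Phi :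
    Prop :=
  [/\ dom L0 Phi,
      aeq (fun x => act L0 Phi x + 'i%C * (gamma * W x)%:C * Phi x
                    - g%:C * `|Phi x| ^+ 2 * Phi x)
          (fun x => mu%:C * Phi x),
      forall x, Phi x = conjc (Phi (- x))
    & exp_decay Phi].

(* The 2 x 2 operator matrix [[L0 + a, b], [c, L0 + d]] on D(L0) x D(L0).      *)
Definition operator_matrix (L0 : operator (cfun R)) (a b c d : cfun R) :
    operator (cfun2 R) :=
  Operator [set u : cfun2 R | dom L0 u.1 /\ dom L0 u.2]
    (fun u => (fun x => act L0 u.1 x + a x * u.1 x + b x * u.2 x,
               fun x => c x * u.1 x + act L0 u.2 x + d x * u.2 x)).

Definition linearization (L0 : operator (cfun R)) W (g mu gamma : R) Phi :
    operator (cfun2 R) :=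
  operator_matrix L0
    (fun x => 'i%C * (gamma * W x)%:C - mu%:C - 2 * g%:C * `|Phi x| ^+ 2)
    (fun x => - g%:C * Phi x ^+ 2)
    (fun x => - g%:C * conjc (Phi x) ^+ 2)
    (fun x => - 'i%C * (gamma * W x)%:C - mu%:C - 2 * g%:C * `|Phi x| ^+ 2).

Definition adjoint_linearization (L0 : operator (cfun R)) W (g mu gamma : R)
    Phi : operator (cfun2 R) :=
  operator_matrix L0
    (fun x => - 'i%C * (gamma * W x)%:C - mu%:C - 2 * g%:C * `|Phi x| ^+ 2)
    (fun x => - g%:C * Phi x ^+ 2)
    (fun x => - g%:C * conjc (Phi x) ^+ 2)
    (fun x => 'i%C * (gamma * W x)%:C - mu%:C - 2 * g%:C * `|Phi x| ^+ 2).

Definition krein (v0 v0s : cfun2 R) : R[i] := inner2 v0 (sigma3 v0s).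

End PT.

(* Main.v *)
(** Put T = i sigma3 L and w = sigma3 v0#. The problem for v0 reads
    T v0 = lambda0 v0, and since L* is the adjoint of L, the adjoint problem says
    <T u, w> = - conj(lambda0) <u, w> for every u in the domain. With u = v0 this
    gives (lambda0 + conj(lambda0)) K = 0, hence (3). (1) is the change of
    variables x -> -x.

    For (2), lambda0 is imaginary, so <T u, w> = lambda0 <u, w> and thus
    (lambda0 - z) <(T - z)^-1 f, w> = <f, w> for every f. Integrating over the
    circle, the Riesz projection P satisfies <P f, w> = <f, w>; likewise P v0 = v0.
    As P has rank one, K = <v0, w> = 0 would make w orthogonal to the range of P,
    so that <w, w> = <P w, w> = 0. *)

Require Import Defs.
From mathcomp Require Import all_boot all_order all_algebra.
From mathcomp Require Import complex.
From mathcomp Require Import all_classical all_reals all_analysis.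
From mathcomp Require Import measurable_realfun ring lra.

Import Order.TTheory GRing.Theory Num.Theory.
Import numFieldNormedType.Exports.

Local Open Scope ring_scope.
Local Open Scope complex_scope.

Arguments cint : simpl never.
Arguments inner : simpl never.
Arguments inner2 : simpl never.

(** * Modulus, real part and imaginary part of complex numbers *)

Section ComplexL2.
Context {R : realType}.
Implicit Types (f h m : R -> R[i]) (z : R[i]).
Local Notation mu := (@lebesgue_measure R).

Lemma cabsE z : (cabs z)%:C = `|z|.
Proof. by rewrite /cabs RRe_real. Qed.

Lemma cabs_ge0 z : 0 <= cabs z.
Proof. by rewrite -lecR cabsE normr_ge0. Qed.

Lemma cabsM z1 z2 : cabs (z1 * z2) = cabs z1 * cabs z2.
Proof. by apply: complexI; rewrite rmorphM /= !cabsE normrM. Qed.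

Lemma cabsD z1 z2 : cabs (z1 + z2) <= cabs z1 + cabs z2.
Proof. by rewrite -lecR rmorphD /= !cabsE ler_normD. Qed.

Lemma cabsJ z : cabs (conjc z) = cabs z.
Proof. by apply: complexI; rewrite !cabsE normcJ. Qed.

Lemma cabs_eq0 z : (cabs z == 0) = (z == 0).
Proof. by rewrite -(inj_eq (@complexI R)) cabsE normr_eq0. Qed.

Lemma cabs_sqr z : cabs z ^+ 2 = complex.Re z ^+ 2 + complex.Im z ^+ 2.
Proof. by apply: complexI; rewrite rmorphXn /= cabsE add_Re2_Im2. Qed.

Lemma normr_Re_cabs z : `|complex.Re z| <= cabs z.
Proof. by rewrite -lecR cabsE normc_ge_Re. Qed.

Lemma normr_Im_cabs z : `|complex.Im z| <= cabs z.
Proof.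
rewrite -(@ler_pXn2r _ 2%N) // ?nnegrE ?cabs_ge0 // cabs_sqr real_normK ?num_real //.
by rewrite lerDr sqr_ge0.
Qed.

Lemma ReM z1 z2 : complex.Re (z1 * z2) =
  complex.Re z1 * complex.Re z2 - complex.Im z1 * complex.Im z2.
Proof. by case: z1 => ? ?; case: z2. Qed.

Lemma ImM z1 z2 : complex.Im (z1 * z2) =
  complex.Re z1 * complex.Im z2 + complex.Im z1 * complex.Re z2.
Proof. by case: z1 => ? ?; case: z2. Qed.

Lemma ReJ z : complex.Re (conjc z) = complex.Re z.
Proof. by case: z. Qed.

Lemma ImJ z : complex.Im (conjc z) = - complex.Im z.
Proof. by case: z. Qed.

(** * Measurability of complex-valued functions *)

Lemma cmeasurable_cst z : cmeasurable (fun _ : R => z).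
Proof. by split; exact: measurable_cst. Qed.

Lemma cmeasurable_real (f : R -> R) :
  measurable_fun [set: R] f -> cmeasurable (fun x => (f x)%:C).
Proof. by split => //; exact: measurable_cst. Qed.

Lemma cmeasurableD f h :
  cmeasurable f -> cmeasurable h -> cmeasurable (fun x => f x + h x).
Proof.
move=> [fr fi] [hr hi]; split.
  under eq_fun do rewrite raddfD.
  exact: measurable_funD.
under eq_fun do rewrite raddfD.
exact: measurable_funD.
Qed.

Lemma cmeasurableJ f : cmeasurable f -> cmeasurable (fun x => conjc (f x)).
Proof.
move=> [fr fi]; split.
  by under eq_fun do rewrite ReJ.
under eq_fun do rewrite ImJ.
exact: measurableT_comp.
Qed.

Lemma cmeasurableM f h :
  cmeasurable f -> cmeasurable h -> cmeasurable (fun x => f x * h x).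
Proof.
move=> [fr fi] [hr hi]; split.
  under eq_fun do rewrite ReM.
  apply: measurable_funB; apply: measurable_funM => //.
under eq_fun do rewrite ImM.
by apply: measurable_funD; exact: measurable_funM.
Qed.

Lemma cmeasurable_cabs_sqr f : cmeasurable f ->
  measurable_fun [set: R] (fun x => cabs (f x) ^+ 2).
Proof.
move=> [fr fi]; under eq_fun do rewrite cabs_sqr.
by apply: measurable_funD; exact: measurable_funX.
Qed.

(** * Square-integrable functions and bounded multipliers *)

Lemma integrable_EFinD (F G : R -> R) :
  mu.-integrable [set: R] (EFin \o F) -> mu.-integrable [set: R] (EFin \o G) ->
  mu.-integrable [set: R] (EFin \o (fun x => F x + G x)).
Proof. exact: integrableD. Qed.

Lemma integrable_EFinZ (k : R) (F : R -> R) :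
  mu.-integrable [set: R] (EFin \o F) ->
  mu.-integrable [set: R] (EFin \o (fun x => k * F x)).
Proof. exact: integrableZl. Qed.

Lemma le_L2 (G : R -> R) f : cmeasurable f ->
  mu.-integrable [set: R] (EFin \o G) ->
  (forall x, cabs (f x) ^+ 2 <= G x) -> L2 f.
Proof.
move=> mf iG fG; split=> //.
apply: le_integrable iG => //.
  by apply/measurable_EFinP; exact: cmeasurable_cabs_sqr.
move=> x _; rewrite /= lee_fin ger0_norm ?sqr_ge0 //.
exact: le_trans (fG x) (ler_norm _).
Qed.

Lemma L2D f h : L2 f -> L2 h -> L2 (fun x => f x + h x).
Proof.
move=> [mf if_] [mh ih].
apply: (@le_L2 (fun x => 2 * cabs (f x) ^+ 2 + 2 * cabs (h x) ^+ 2)).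
- exact: cmeasurableD.
- by apply: integrable_EFinD; exact: integrable_EFinZ.
move=> x; have := cabsD (f x) (h x).
have := cabs_ge0 (f x + h x).
set a := cabs (f x); set b := cabs (h x); set c := cabs _ => c0 cab.
have : c ^+ 2 <= (a + b) ^+ 2 by rewrite ler_pXn2r ?nnegrE // (le_trans c0).
(* [(a - b)^2 >= 0] gives [(a + b)^2 <= 2 a^2 + 2 b^2], the reason for the dominating function
   chosen above. *)
by have := sqr_ge0 (a - b); nra.
Qed.

(** The class of matrix coefficients of the linearization: multiplication by such a function
    preserves [L2], and the class is closed under sums, products and conjugation. *)
Definition multiplier m : Prop :=
  cmeasurable m /\ exists M : R, forall x, cabs (m x) <= M.

Lemma multiplier_cst z : multiplier (fun=> z).
Proof. by split; [exact: cmeasurable_cst | exists (cabs z)]. Qed.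

Lemma multiplierD m n : multiplier m -> multiplier n ->
  multiplier (fun x => m x + n x).
Proof.
move=> [mm [M hM]] [mn [N hN]]; split; first exact: cmeasurableD.
by exists (M + N) => x; apply: le_trans (cabsD _ _) _; rewrite lerD.
Qed.

Lemma multiplierM m n : multiplier m -> multiplier n ->
  multiplier (fun x => m x * n x).
Proof.
move=> [mm [M hM]] [mn [N hN]]; split; first exact: cmeasurableM.
by exists (M * N) => x; rewrite cabsM ler_pM ?cabs_ge0.
Qed.

Lemma multiplierJ m : multiplier m -> multiplier (fun x => conjc (m x)).
Proof.
move=> [mm [M hM]]; split; first exact: cmeasurableJ.
by exists M => x; rewrite cabsJ.
Qed.

Lemma L2M m f : multiplier m -> L2 f -> L2 (fun x => m x * f x).
Proof.
move=> [mm [M hM]] [mf if_].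
apply: (@le_L2 (fun x => M ^+ 2 * cabs (f x) ^+ 2)).
- exact: cmeasurableM.
- exact: integrable_EFinZ.
move=> x; rewrite cabsM exprMn ler_wpM2r ?sqr_ge0 //.
rewrite ler_pXn2r ?nnegrE ?cabs_ge0 //.
exact: le_trans (cabs_ge0 _) (hM x).
Qed.

Lemma L2Z z f : L2 f -> L2 (fun x => z * f x).
Proof. by apply: L2M; exact: multiplier_cst. Qed.

(** * Complex integrals and the sesquilinear inner product *)

Definition reim_integrable f : Prop :=
  mu.-integrable [set: R] (EFin \o (fun x => complex.Re (f x))) /\
  mu.-integrable [set: R] (EFin \o (fun x => complex.Im (f x))).

(** The product is dominated through [a b <= a^2 + b^2], and its real and imaginary parts are
    dominated by its modulus. This licenses every use of linearity of the integral inside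
    [inner]. *)
Lemma L2_mulJ f h : L2 f -> L2 h -> reim_integrable (fun x => f x * conjc (h x)).
Proof.
move=> [mf if_] [mh ih].
have [mr mi] := cmeasurableM f _ mf (cmeasurableJ h mh).
have iG : mu.-integrable [set: R]
    (EFin \o (fun x => cabs (f x) ^+ 2 + cabs (h x) ^+ 2)).
  exact: integrable_EFinD.
have le x : cabs (f x * conjc (h x)) <= cabs (f x) ^+ 2 + cabs (h x) ^+ 2.
  rewrite cabsM cabsJ; have := cabs_ge0 (f x); have := cabs_ge0 (h x).
  set a := cabs _; set b := cabs _ => a0 b0.
  by have := sqr_ge0 (a - b); nra.
split; apply: le_integrable iG => //; try exact/measurable_EFinP.
- move=> x _; rewrite /= lee_fin; apply: le_trans (normr_Re_cabs _) _.
  exact: le_trans (le x) (ler_norm _).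
move=> x _; rewrite /= lee_fin; apply: le_trans (normr_Im_cabs _) _.
exact: le_trans (le x) (ler_norm _).
Qed.

Lemma cintD f h : reim_integrable f -> reim_integrable h ->
  cint [set: R] (fun x => f x + h x) = cint [set: R] f + cint [set: R] h.
Proof.
move=> [fr fi] [hr hi]; rewrite /cint.
under eq_Rintegral do rewrite raddfD.
under [in X in _ +i* X]eq_Rintegral do rewrite raddfD.
by rewrite !RintegralD.
Qed.

Lemma cintZ z f : reim_integrable f ->
  cint [set: R] (fun x => z * f x) = z * cint [set: R] f.
Proof.
move=> [fr fi]; rewrite /cint.
under eq_Rintegral do rewrite ReM.
under [in X in _ +i* X]eq_Rintegral do rewrite ImM.
rewrite RintegralB ?RintegralD ?RintegralZl //; try exact: integrable_EFinZ.
by case: z.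
Qed.

Lemma cintJ f : reim_integrable f ->
  cint [set: R] (fun x => conjc (f x)) = conjc (cint [set: R] f).
Proof.
move=> [fr fi]; rewrite /cint.
under eq_Rintegral do rewrite ReJ.
under [in X in _ +i* X]eq_Rintegral do rewrite ImJ -mulN1r.
by rewrite RintegralZl // mulN1r.
Qed.

Lemma cint_ae f h : cmeasurable f -> cmeasurable h -> aeq f h ->
  cint [set: R] f = cint [set: R] h.
Proof.
move=> [fr fi] [hr hi] fh; rewrite /cint /Rintegral; congr (fine _ +i* fine _).
- apply: ae_eq_integral => //; try exact/measurable_EFinP.
  exact: (ae_eq_comp (fun z => (complex.Re z)%:E) fh).
- apply: ae_eq_integral => //; try exact/measurable_EFinP.
  exact: (ae_eq_comp (fun z => (complex.Im z)%:E) fh).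
Qed.

Lemma innerDl f1 f2 h : L2 f1 -> L2 f2 -> L2 h ->
  inner (fun x => f1 x + f2 x) h = inner f1 h + inner f2 h.
Proof.
move=> L1 L2' Lh; rewrite /inner; under eq_fun do rewrite mulrDl.
by apply: cintD; exact: L2_mulJ.
Qed.

Lemma innerZl z f h : L2 f -> L2 h ->
  inner (fun x => z * f x) h = z * inner f h.
Proof.
move=> Lf Lh; rewrite /inner; under eq_fun do rewrite -mulrA.
by apply: cintZ; exact: L2_mulJ.
Qed.

Lemma innerJ f h : L2 f -> L2 h -> inner f h = conjc (inner h f).
Proof.
move=> Lf Lh; rewrite /inner -cintJ; last exact: L2_mulJ.
by congr cint; apply/funext => x; rewrite rmorphM /= conjcK mulrC.
Qed.

Lemma innerDr f h1 h2 : L2 f -> L2 h1 -> L2 h2 ->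
  inner f (fun x => h1 x + h2 x) = inner f h1 + inner f h2.
Proof.
move=> Lf L1 L2'; rewrite innerJ //; last exact: L2D.
rewrite innerDl // (innerJ f h1) // (innerJ f h2) //; exact: rmorphD.
Qed.

(** The two integrands agree pointwise, so this is an identity of integrals whatever the functions
    are. *)
Lemma inner_mulJ m f h :
  inner (fun x => m x * f x) h = inner f (fun x => conjc (m x) * h x).
Proof.
by congr cint; apply/funext => x; rewrite rmorphM /= conjcK mulrCA mulrA.
Qed.

Lemma innerZr z f h : L2 f -> L2 h ->
  inner f (fun x => z * h x) = conjc z * inner f h.
Proof. by move=> Lf Lh; rewrite -[in LHS](conjcK z) -inner_mulJ innerZl. Qed.

Lemma innerNr f h : L2 f -> L2 h -> inner f (fun x => - h x) = - inner f h.
Proof.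
move=> Lf Lh; under [X in inner f X]eq_fun do rewrite -mulN1r.
by rewrite innerZr // rmorphN1 mulN1r.
Qed.

Lemma inner_ae f f' h h' : cmeasurable f -> cmeasurable f' ->
  cmeasurable h -> cmeasurable h' -> aeq f f' -> aeq h h' ->
  inner f h = inner f' h'.
Proof.
move=> mf mf' mh mh' ff hh; apply: cint_ae.
- by apply: cmeasurableM => //; exact: cmeasurableJ.
- by apply: cmeasurableM => //; exact: cmeasurableJ.
- by apply: filterS2 ff hh => x /= ff hh _; rewrite ff // hh.
Qed.

Lemma inner_self f : inner f f = (\int[mu]_x (cabs (f x) ^+ 2))%:C.
Proof.
rewrite /inner /cint; congr Complex.
  apply: eq_Rintegral => x _.
  by rewrite ReM ReJ ImJ cabs_sqr mulrN opprK !expr2.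
under eq_Rintegral do rewrite ImM ReJ ImJ mulrN mulrC addNr.
by rewrite Rintegral_cst // mul0r.
Qed.

Lemma inner_self_eq0 f : L2 f -> inner f f = 0 -> aeq f (fun=> 0).
Proof.
move=> [mf if_]; rewrite inner_self => -[] /eqP.
(* [fine] also sends infinite values to 0, so the extended integral is known to vanish only once it
   is known to be finite, which membership in [L2] provides. *)
rewrite /Rintegral fine_eq0; last exact: integrable_fin_num.
move=> /eqP f0.
have : (\int[mu]_x `|(cabs (f x) ^+ 2)%:E| = 0)%E.
  by rewrite -[RHS]f0; apply: eq_integral => x _; rewrite /= ger0_norm ?sqr_ge0.
move/ae_eq_integral_abs => /(_ measurableT).
have mE : measurable_fun [set: R] (fun x => (cabs (f x) ^+ 2)%:E).
  by apply/measurable_EFinP; exact: cmeasurable_cabs_sqr.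
move=> /(_ mE); apply: filterS => x /= /(_ I)[] /eqP.
by rewrite sqrf_eq0 cabs_eq0 => /eqP.
Qed.

(** * The reflection [x -> -x] and reality of inner products of PT-symmetric functions *)

Lemma Rintegral_reflect (F : R -> R) :
  measurable_fun [set: R] F ->
  \int[mu]_x F (- x) = \int[mu]_x F x.
Proof.
move=> mF; rewrite /Rintegral; congr fine.
have ge0 (G : R -> \bar R) : measurable_fun [set: R] G -> (forall x, (0 <= G x)%E) ->
    (\int[mu]_x G (- x)%R = \int[mu]_x G x)%E.
  move=> mG G0.
  (* For nonnegative functions the change of variables is integration against the pushforward of
     Lebesgue measure by negation, which is Lebesgue measure again. *)
  rewrite -[LHS](@ge0_integral_pushforward _ _ (measurableTypeR R) _ _
    (-%R : _ -> measurableTypeR R) _ mu setT G) //.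
  by apply: eq_measure_integral => A mA _; exact: lebesgue_measureN.
(* The general case splits into positive and negative parts, each covered by the nonnegative
   case. *)
rewrite integralE [RHS]integralE.
have mE : measurable_fun [set: R] (EFin \o F) by apply/measurable_EFinP.
congr (_ - _)%E.
  rewrite -[RHS](ge0 _ (measurable_funepos mE) (funepos_ge0 _)).
  by apply: eq_integral => x _; rewrite !funeposE.
rewrite -[RHS](ge0 _ (measurable_funeneg mE) (funeneg_ge0 _)).
by apply: eq_integral => x _; rewrite !funenegE.
Qed.

Lemma cint_reflect f : cmeasurable f ->
  cint [set: R] (fun x => f (- x)) = cint [set: R] f.
Proof.
move=> [fr fi]; rewrite /cint.
by rewrite -(Rintegral_reflect _ fr) -(Rintegral_reflect _ fi).
Qed.

Lemma cmeasurable_reflect f : cmeasurable f -> cmeasurable (fun x => f (- x)).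
Proof.
by move=> [fr fi]; split; [apply: (measurableT_comp fr) | apply: (measurableT_comp fi)].
Qed.

(** PT symmetry replaces both factors by reflected conjugates; undoing the reflection in the
    integral shows that the inner product equals its own conjugate. *)
Lemma inner_PT_real f h : L2 f -> L2 h -> PT_symmetric f -> PT_symmetric h ->
  inner f h \is Num.real.
Proof.
move=> Lf Lh Pf Ph; have [[mf _] [mh _]] := (Lf, Lh).
have mr (k : R -> R[i]) : cmeasurable k -> cmeasurable (fun x => conjc (k (- x))).
  by move=> mk; exact: (cmeasurableJ _ (cmeasurable_reflect _ mk)).
have e : inner f h = conjc (inner f h).
  rewrite {1}(inner_ae _ _ _ _ mf (mr _ mf) mh (mr _ mh) Pf Ph).
  rewrite /inner -cintJ; last exact: L2_mulJ.
  rewrite -[RHS]cint_reflect; last first.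
    by apply: cmeasurableJ; apply: cmeasurableM => //; exact: cmeasurableJ.
  by congr cint; apply/funext => x; rewrite rmorphM.
(* For [a + i b], equality with the conjugate leaves [b = - b], hence [2 b = 0]. *)
case: (inner f h) e => a b [] /eqP; rewrite complex_real -addr_eq0 -mulr2n.
by rewrite mulrn_eq0.
Qed.

End ComplexL2.

(** * Pairs of functions and their inner product *)

Section Pairs.
Context {R : realType}.
Implicit Types (u v w h : (R -> R[i]) * (R -> R[i])) (c z lam : R[i])
  (T : operator ((R -> R[i]) * (R -> R[i]))).
Local Notation mu := (@lebesgue_measure R).

(** One operation serves for sums, multiples (with [v := zero2]) and differences (with [c := -1]),
    so that a single linearity lemma for [inner2] suffices. *)
Definition lin2 c u v : (R -> R[i]) * (R -> R[i]) :=
  (fun x => c * u.1 x + v.1 x, fun x => c * u.2 x + v.2 x).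

Lemma L2x2_lin2 c u v : L2x2 u -> L2x2 v -> L2x2 (lin2 c u v).
Proof. by move=> [u1 u2] [v1 v2]; split; apply: L2D => //; exact: L2Z. Qed.

Lemma L2x2_sigma3 u : L2x2 u -> L2x2 (sigma3 u).
Proof.
move=> [u1 u2]; split => //; rewrite /sigma3 /=.
by under eq_fun do rewrite -mulN1r; exact: L2Z.
Qed.

Lemma inner2_lin2 c u v h : L2x2 u -> L2x2 v -> L2x2 h ->
  inner2 (lin2 c u v) h = c * inner2 u h + inner2 v h.
Proof.
move=> [u1 u2] [v1 v2] [h1 h2]; rewrite /inner2 /lin2 /=.
rewrite !innerDl //; try exact: L2Z.
by rewrite !innerZl //; ring.
Qed.

Lemma inner2_ae u v w h : L2x2 u -> L2x2 v -> L2x2 w -> L2x2 h ->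
  aeq2 u v -> aeq2 w h -> inner2 u w = inner2 v h.
Proof.
move=> [[? _] [? _]] [[? _] [? _]] [[? _] [? _]] [[? _] [? _]] [? ?] [? ?].
by congr (_ + _); exact: inner_ae.
Qed.

Lemma aeq2_refl u : aeq2 u u.
Proof. by split; exact: ae_eq_refl. Qed.

Lemma aeq2_sym u v : aeq2 u v -> aeq2 v u.
Proof. by move=> [uv1 uv2]; split; exact: ae_eq_sym. Qed.

Lemma aeq2_trans u v w : aeq2 u v -> aeq2 v w -> aeq2 u w.
Proof.
move=> [uv1 uv2] [vw1 vw2].
by split; [exact: ae_eq_trans vw1 | exact: ae_eq_trans vw2].
Qed.

Lemma inner2_self_eq0 u : L2x2 u -> inner2 u u = 0 -> aeq2 u zero2.
Proof.
move=> [L1 L2'] e.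
have ge0 f : 0 <= (\int[mu]_x (cabs (f x) ^+ 2) : R).
  by apply: Rintegral_ge0 => x _; exact: sqr_ge0.
move: (e); rewrite /inner2 !inner_self -rmorphD /= => -[] /eqP.
rewrite paddr_eq0 // => /andP[/eqP e1 /eqP e2].
by split; apply: inner_self_eq0; rewrite // inner_self ?e1 ?e2.
Qed.

Lemma L2x2_0 : L2x2 (zero2 : (R -> R[i]) * (R -> R[i])).
Proof.
have L20 : L2 (fun _ : R => 0 : R[i]).
  apply: (@le_L2 R (fun=> 0)); [exact: cmeasurable_cst | exact: integrable0 |].
  by move=> x; rewrite cabs_sqr expr0n addr0.
by split.
Qed.

Lemma inner2_0l h : L2x2 h -> inner2 zero2 h = 0.
Proof.
move=> Lh; have e : zero2 = lin2 (-1) h h by congr pair; apply/funext => x /=; ring.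
by rewrite {1}e inner2_lin2 // mulN1r addNr.
Qed.

(** The properties of [T] that the spectral argument relies on; linearity of the action is up to
    almost-everywhere equality, as for classes in [L2]. *)
Definition linear_operator2 T : Prop :=
  [/\ forall u, dom T u -> L2x2 u, forall u, dom T u -> L2x2 (act T u)
    & forall c u v, dom T u -> dom T v -> dom T (lin2 c u v) /\
        aeq2 (act T (lin2 c u v)) (lin2 c (act T u) (act T v))].

(** * Riesz projections paired with eigenvectors and adjoint eigenvectors *)

Lemma shiftE T z u : Defs.shift T z u = lin2 (- z) u (act T u).
Proof. by congr pair; apply/funext => x /=; ring. Qed.

Lemma cabs_circle (r t : R) : 0 < r -> cabs (r%:C * expi t) = r.
Proof.
move=> r0; have : cabs (r%:C * expi t) ^+ 2 = r ^+ 2.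
  rewrite cabs_sqr ReM ImM /= !mul0r subr0 addr0 !exprMn -mulrDr cos2Dsin2.
  by rewrite mulr1.
by move/eqP; rewrite eqrXn2 ?cabs_ge0 ?ltW // => /eqP.
Qed.

Lemma cint_cst (a b : R) c : a <= b ->
  cint `[a, b]%classic (fun=> c) = (b - a)%:C * c.
Proof.
move=> ab; rewrite /cint !Rintegral_cst //.
have -> : fine (mu `[a, b]%classic) = b - a.
  rewrite lebesgue_measure_itv /= lte_fin; case: ltP => // ba.
  by have -> : b = a; [apply/le_anti; rewrite ba | rewrite subrr].
by case: c => x y; simpc; rewrite mulrC (mulrC y).
Qed.

(** The resolvent identity is left as a hypothesis because it is met in two ways: when [h] is an
    adjoint eigenvector and [f] is arbitrary, and when [f] is an eigenvector and [h] is
    arbitrary. *)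
Lemma riesz_projection_inner T lam P f h : is_riesz_projection T lam P ->
  L2x2 f -> L2x2 h ->
  (forall z S, is_resolvent T z S -> (lam - z) * inner2 (S f) h = inner2 f h) ->
  inner2 (P f) h = inner2 f h.
Proof.
move=> [r [Res [r0 hRes _ hP]]] Lf Lh hS; rewrite hP //.
under [X in cint _ X]eq_fun => t.
  have cz : cabs (lam + r%:C * expi t - lam) = r by rewrite addrC addKr cabs_circle.
  (* At [z = lam + r e^(i t)] the factor [r e^(i t)] is [- (lam - z)], so the contour integrand is
     the constant [- <f, h>]; integrating it over a length of [2 pi] cancels the prefactor
     [- 1 / (2 pi)]. *)
  rewrite (_ : _ * _ = - inner2 f h); last first.
    rewrite -(hS (lam + r%:C * expi t) (Res (lam + r%:C * expi t))); first ring.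
    by apply: hRes; rewrite cz r0 lexx.
  over.
have pi2 : 0 < 2 * pi :> R by rewrite mulr_gt0 // pi_gt0.
rewrite cint_cst ?ltW // subr0 mulrN mulrNN mulrA -rmorphM /=.
by rewrite mulVf ?gt_eqF // mul1r.
Qed.

(** Pairing [(T - z) (S f) = f] with [w] and moving [T] across by [hw] gives
    [(lam - z) <S f, w> = <f, w>]. *)
Lemma riesz_projection_adjoint T lam P f w : linear_operator2 T ->
  is_riesz_projection T lam P -> L2x2 f -> L2x2 w ->
  (forall u, dom T u -> inner2 (act T u) w = lam * inner2 u w) ->
  inner2 (P f) w = inner2 f w.
Proof.
move=> [Ld La _] hP Lf Lw hw; apply: (riesz_projection_inner _ _ _ _ _ hP Lf Lw).
move=> z S [hS _ _]; have [dS eS] := hS f Lf.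
have LS : L2x2 (Defs.shift T z (S f)).
  by rewrite shiftE; apply: L2x2_lin2; [exact: Ld | exact: La].
rewrite -(inner2_ae _ _ _ _ LS Lf Lw Lw eS (aeq2_refl w)) shiftE.
by rewrite inner2_lin2 ?hw //; [ring | exact: Ld | exact: La].
Qed.

(** The resolvent acts on [v] as division by [lam - z], so the weak form of the contour integral
    gives [<P v, h> = <v, h>] for every [h]. *)
Lemma riesz_projection_eigenvector T lam P v : linear_operator2 T ->
  is_riesz_projection T lam P -> dom T v ->
  aeq2 (act T v) (lin2 lam v zero2) -> aeq2 (P v) v.
Proof.
move=> [Ld La lin] hP dv ev; have Lv := Ld _ dv.
have LP : L2x2 (P v) by case: hP => r [Res [_ _ + _]]; exact.
have e h : L2x2 h -> inner2 (P v) h = inner2 v h.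
  move=> Lh; apply: (riesz_projection_inner _ _ _ _ _ hP Lv Lh) => z S [hS inj _].
  have [dS eS] := hS v Lv; have LS := Ld _ dS.
  have [du eu] := lin (z - lam) _ _ dS dv.
  (* [T - z] sends [(z - lam) S v + v] to [(z - lam) v + (lam - z) v = 0], and it is injective up to
     almost-everywhere equality. *)
  suff : aeq2 (lin2 (z - lam) (S v) v) zero2.
    move=> u0; have := inner2_ae _ _ _ _ (Ld _ du) L2x2_0 Lh Lh u0 (aeq2_refl h).
    rewrite inner2_0l // inner2_lin2 // => /eqP.
    by rewrite addrC addr_eq0 => /eqP ->; ring.
  apply: inj => //; move: eS; rewrite !shiftE => -[s1 s2].
  case: eu => a1 a2; case: ev => b1 b2; split.
    apply: filterS3 s1 a1 b1 => x /= /(_ I) s1 /(_ I) -> /(_ I) -> _.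
    by move: s1 => /= <-; ring.
  apply: filterS3 s2 a2 b2 => x /= /(_ I) s2 /(_ I) -> /(_ I) -> _.
  by move: s2 => /= <-; ring.
(* The weak identity is tested on the difference [P v - v] itself. *)
have Ld' : L2x2 (lin2 (-1) v (P v)) by exact: L2x2_lin2.
have : aeq2 (lin2 (-1) v (P v)) zero2.
  apply: inner2_self_eq0 => //.
  by rewrite {1}inner2_lin2 // (e _ Ld') mulN1r addNr.
move=> [z1 z2]; split.
  by apply: filterS z1 => x /= /(_ I) /eqP; rewrite mulN1r addrC subr_eq0 => /eqP.
by apply: filterS z2 => x /= /(_ I) /eqP; rewrite mulN1r addrC subr_eq0 => /eqP.
Qed.

(** Let [e] span the range of [P], with [P v = d e] and [P w = c e]. Then [<v, w> = d <e, w>] and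
    [<w, w> = c <e, w>]. If the first vanishes, either [d = 0] and [v = P v = 0], or [<e, w> = 0]
    and [w = 0]. *)
Lemma simple_eigenvector_adjoint_neq0 T lam v w : linear_operator2 T ->
  algebraic_multiplicity T lam 1 -> dom T v -> ~ aeq2 v zero2 ->
  aeq2 (act T v) (lin2 lam v zero2) -> L2x2 w -> ~ aeq2 w zero2 ->
  (forall u, dom T u -> inner2 (act T u) w = lam * inner2 u w) ->
  inner2 v w != 0.
Proof.
move=> lT [P hP [e [eS _ span]]] dv v0 ev Lw w0 hw; apply/eqP => vw0.
have Lv : L2x2 v by case: lT => Ld _ _; exact: Ld.
have LP f : L2x2 f -> L2x2 (P f) by case: hP => r [Res [_ _ + _]]; exact.
have Le : L2x2 (e ord0) by have [f Lf <-] := eS ord0; exact: LP.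
have {}span f : L2x2 f -> exists c, aeq2 (P f) (lin2 c (e ord0) zero2).
  move=> Lf; have [|c Pc] := span (P f); first by exists f.
  exists (c ord0); rewrite (_ : lin2 _ _ _ = lincomb2 c e) //.
  by congr pair; apply/funext => x /=; rewrite big_ord1 addr0.
have inner_e f c : L2x2 f -> aeq2 (P f) (lin2 c (e ord0) zero2) ->
    inner2 f w = c * inner2 (e ord0) w.
  move=> Lf Pf; rewrite -(riesz_projection_adjoint T lam P f w) //.
  have Lc : L2x2 (lin2 c (e ord0) zero2) by apply: L2x2_lin2 => //; exact: L2x2_0.
  rewrite (inner2_ae _ _ _ _ (LP _ Lf) Lc Lw Lw Pf (aeq2_refl w)).
  by rewrite inner2_lin2 ?inner2_0l ?addr0 //; exact: L2x2_0.
have [d Pd] := span v Lv; have [c Pc] := span w Lw.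
have : d * inner2 (e ord0) w = 0 by rewrite -(inner_e v).
move/eqP; rewrite mulf_eq0 => /orP[/eqP d0|/eqP ew0].
  have Pv := riesz_projection_eigenvector _ _ _ _ lT hP dv ev.
  apply: v0; apply: aeq2_trans (aeq2_sym _ _ Pv) _.
  rewrite d0 in Pd; rewrite (_ : zero2 = lin2 0 (e ord0) zero2) //.
  by congr pair; apply/funext => x /=; ring.
by apply: w0; apply: inner2_self_eq0; rewrite // (inner_e _ _ Lw Pc) ew0 mulr0.
Qed.

(** * The operator matrix, its formal adjoint and multiplication by [i sigma3] *)

Lemma linear_isigma3 T : linear_operator2 T -> linear_operator2 (isigma3 T).
Proof.
move=> [Ld La lin]; split => //.
  by move=> u /La[L1 L2']; split; exact: L2Z.
move=> c u v du dv; have [dl [l1 l2]] := lin c u v du dv; split=> //; split.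
  by apply: filterS l1 => x /= /(_ I) -> _; ring.
by apply: filterS l2 => x /= /(_ I) -> _; ring.
Qed.

Lemma linear_operator_matrix (L0 : operator (R -> R[i])) (a b c d : R -> R[i]) :
  L2_operator L0 -> multiplier a -> multiplier b -> multiplier c ->
  multiplier d -> linear_operator2 (operator_matrix L0 a b c d).
Proof.
move=> [L2L _ _ lin] ma mb mc md; split.
- by move=> u [/L2L[? _] /L2L[? _]].
- move=> u [/L2L[? ?] /L2L[? ?]]; split.
    by apply: L2D; [apply: L2D => // | ]; exact: L2M.
  by apply: L2D; [apply: L2D => // | ]; exact: L2M.
move=> k u v [du1 du2] [dv1 dv2].
have [dl1 l1] := lin k _ _ du1 dv1; have [dl2 l2] := lin k _ _ du2 dv2.
split; first by split.
split.
  by apply: filterS l1 => x /= /(_ I) -> _; ring.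
by apply: filterS l2 => x /= /(_ I) -> _; ring.
Qed.

(** The adjoint matrix is the conjugate transpose: [L0] is symmetric, and bounded coefficients cross
    the inner product by conjugation. *)
Lemma operator_matrix_adjoint (L0 : operator (R -> R[i])) (a b c d : R -> R[i]) u v :
  self_adjoint L0 -> multiplier a -> multiplier b -> multiplier c ->
  multiplier d -> dom L0 u.1 -> dom L0 u.2 -> dom L0 v.1 -> dom L0 v.2 ->
  inner2 (act (operator_matrix L0 a b c d) u) v =
  inner2 u (act (operator_matrix L0 (fun x => conjc (a x)) (fun x => conjc (c x))
    (fun x => conjc (b x)) (fun x => conjc (d x))) v).
Proof.
move=> [[L2L _ _ _] _ sa] ma mb mc md du1 du2 dv1 dv2.
(* Symmetry is one direction of self-adjointness: the pair of [h] and [act L0 h] lies in the graph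
   of the adjoint. *)
have sym (f h : R -> R[i]) : dom L0 f -> dom L0 h ->
    inner (act L0 f) h = inner f (act L0 h).
  move=> df dh; have [_ LAh] := L2L _ dh.
  by have [_ /(_ (conj dh (ae_eq_refl _ _ _)))[_ _ ->]] := sa h _ LAh.
have [Lu1 LAu1] := L2L _ du1; have [Lu2 LAu2] := L2L _ du2.
have [Lv1 LAv1] := L2L _ dv1; have [Lv2 LAv2] := L2L _ dv2.
have LM (m f : R -> R[i]) : multiplier m -> L2 f -> L2 (fun x => m x * f x) by exact: L2M.
have LJ (m f : R -> R[i]) : multiplier m -> L2 f -> L2 (fun x => conjc (m x) * f x).
  by move=> mm; apply: L2M; exact: multiplierJ.
rewrite /inner2 /=.
rewrite !innerDl ?innerDr //; try (by auto); try (by apply: L2D; auto).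
by rewrite !sym // !inner_mulJ; ring.
Qed.

(** Since [sigma3] is symmetric and squares to the identity, [<i sigma3 L u, sigma3 v> = i <L u, v>
    = i <u, L* v>]. Inserting [L* v = - i lam sigma3 v] yields the factor [i * conj(- i lam) = i * i
    * conj lam = - conj lam]. *)
Lemma isigma3_adjoint (L0 : operator (R -> R[i])) (a b c d : R -> R[i]) lam u v :
  self_adjoint L0 -> multiplier a -> multiplier b -> multiplier c ->
  multiplier d -> dom L0 u.1 -> dom L0 u.2 ->
  krein_eigenvector (operator_matrix L0 (fun x => conjc (a x))
    (fun x => conjc (c x)) (fun x => conjc (b x)) (fun x => conjc (d x))) lam v ->
  inner2 (act (isigma3 (operator_matrix L0 a b c d)) u) (sigma3 v) =
  - conjc lam * inner2 u (sigma3 v).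
Proof.
move=> sa ma mb mc md du1 du2 [[dv1 dv2] _ ev].
have [L2L _ _] := sa.
have [Ld La _] := linear_operator_matrix _ _ _ _ _ L2L ma mb mc md.
have [Ld' La' _] := linear_operator_matrix _ _ _ _ _ L2L
  (multiplierJ _ ma) (multiplierJ _ mc) (multiplierJ _ mb) (multiplierJ _ md).
have Lu := Ld u (conj du1 du2); have [LAu1 LAu2] := La u (conj du1 du2).
have Lv := Ld' v (conj dv1 dv2); have LAv := La' v (conj dv1 dv2).
have Ls := L2x2_sigma3 _ Lv; have [Ls1 Ls2] := Ls.
have [[Lu1 Lu2] [Lv1 Lv2]] := (Lu, Lv).
have -> : inner2 (act (isigma3 (operator_matrix L0 a b c d)) u) (sigma3 v) =
    'i%C * inner2 (act (operator_matrix L0 a b c d) u) v.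
  rewrite /inner2 [in LHS]/= innerZl // innerZl //.
  by rewrite (innerNr _ v.2) //; ring.
rewrite operator_matrix_adjoint //.
rewrite (inner2_ae _ _ _ _ Lu Lu LAv _ (aeq2_refl u) ev); last first.
  by split; exact: L2Z.
have cE : conjc (- 'i%C * lam) = 'i%C * conjc lam.
  by case: lam {ev} => p q; simpc; congr Complex; ring.
have := @sqr_i R; rewrite expr2 => i2.
rewrite /inner2 [in LHS]/= !innerZr // cE -mulrDr !mulrA i2.
by rewrite mulN1r.
Qed.

Lemma krein_eigenvector_isigma3 T lam v : krein_eigenvector T lam v ->
  aeq2 (act (isigma3 T) v) (lin2 lam v zero2).
Proof.
have := @sqr_i R; rewrite expr2 => i2.
(* Multiplying the eigenvalue equation by [i sigma3] cancels [- i sigma3] in each component; the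
   trailing [+ 0] is the [zero2] summand of [lin2]. *)
have K1 z : 'i%C * (- 'i%C * lam * z) = lam * z + 0.
  by rewrite addr0 !mulNr mulrN !mulrA i2 mulN1r mulNr opprK.
have K2 z : - 'i%C * (- 'i%C * lam * - z) = lam * z + 0.
  by rewrite -K1; ring.
move=> [_ _ [e1 e2]]; split.
  apply: filterS e1 => x /(_ I) e _.
  exact: etrans (congr1 (fun z => 'i%C * z) e) (K1 _).
apply: filterS e2 => x /(_ I) e _.
exact: etrans (congr1 (fun z => - 'i%C * z) e) (K2 _).
Qed.

Lemma krein_PT_real u v : L2x2 u -> L2x2 v ->
  PT_symmetric u.1 -> PT_symmetric u.2 -> PT_symmetric v.1 -> PT_symmetric v.2 ->
  krein u v \is Num.real.
Proof.
move=> [Lu1 Lu2] /L2x2_sigma3[Lv1 Lv2] Pu1 Pu2 Pv1 Pv2.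
apply: rpredD; apply: inner_PT_real => //.
by apply: filterS Pv2 => x /= /(_ I) -> _; rewrite rmorphN.
Qed.

Lemma exp_decay_multiplier (f : R -> R[i]) :
  cmeasurable f -> exp_decay f -> multiplier f.
Proof.
move=> mf [C [kappa [C0 k0 fC]]]; split=> //; exists C => x.
apply: le_trans (fC x) _; rewrite ger_pMr // -[leRHS]expR0 ler_expR.
by rewrite mulNr oppr_le0 mulr_ge0 // ltW.
Qed.

(** Puts the adjoint linearization in the conjugate-transpose form required by [isigma3_adjoint];
    each entry is compared by real and imaginary parts. *)
Lemma adjoint_linearizationE (L0 : operator (R -> R[i])) (W : R -> R)
    (g nu gamma : R) (Phi : R -> R[i]) :
  adjoint_linearization L0 W g nu gamma Phi =
  operator_matrix L0
    (fun x => conjc ('i%C * (gamma * W x)%:C - nu%:C - 2 * g%:C * `|Phi x| ^+ 2))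
    (fun x => conjc (- g%:C * conjc (Phi x) ^+ 2))
    (fun x => conjc (- g%:C * Phi x ^+ 2))
    (fun x => conjc (- 'i%C * (gamma * W x)%:C - nu%:C - 2 * g%:C * `|Phi x| ^+ 2)).
Proof.
by congr operator_matrix; apply/funext => x; rewrite ?sqr_normc;
  case: (Phi x) => p q; rewrite ?expr2; simpc; congr Complex; ring.
Qed.

End Pairs.

(** * The linearized operator: boundedness of its coefficients and the three claims on the Krein
    quantity *)

Theorem lemma4 (R : realType) (V W : R -> R) (g mu gammastar gamma : R)
    (L0 : operator (R -> R[i])) (Phi : R -> R -> R[i])
    (lambda0 : R[i]) (v0 v0s : (R -> R[i]) * (R -> R[i]))
    (hVm : measurable_fun [set: R] V) (hWm : measurable_fun [set: R] W)
    (hV : forall x : R, V (- x) = V x) (hW : forall x : R, W (- x) = - W x)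
    (hg : g = 1 \/ g = - 1)
    (A1 : self_adjoint_extension V L0)
    (A2 : exp_decay (fun x => (W x)%:C))
    (hgammastar : 0 < gammastar)
    (A3 : forall t : R, - gammastar < t < gammastar ->
       stationary_state L0 W g mu t (Phi t))
    (A3_analytic : real_analytic L0 gammastar Phi)
    (hgamma : - gammastar < gamma < gammastar)
    (hlambda0 : lambda0 != 0)
    (hsimple : simple_isolated_eigenvalue
       (linearization L0 W g mu gamma (Phi gamma)) lambda0)
    (hsimples : simple_isolated_eigenvalue
       (adjoint_linearization L0 W g mu gamma (Phi gamma)) lambda0)
    (hv0 : krein_eigenvector
       (linearization L0 W g mu gamma (Phi gamma)) lambda0 v0)
    (hv0s : krein_eigenvector
       (adjoint_linearization L0 W g mu gamma (Phi gamma)) lambda0 v0s)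
    (hPT : complex.Re lambda0 = 0 ->
       [/\ PT_symmetric v0.1, PT_symmetric v0.2,
           PT_symmetric v0s.1 & PT_symmetric v0s.2]) :
  [/\ complex.Re lambda0 = 0 -> krein v0 v0s \is Num.real,
      complex.Re lambda0 = 0 -> krein v0 v0s != 0
    & complex.Re lambda0 != 0 -> krein v0 v0s = 0].
Proof.
set T := linearization L0 W g mu gamma (Phi gamma) in hsimple hv0 *.
have [sa _] := A1; have [L2L _ _] := sa.
have [dPhi _ _ ePhi] := A3 gamma hgamma.
have mPhi : multiplier (Phi gamma).
  by apply: exp_decay_multiplier ePhi; case: L2L => /(_ _ dPhi)[[]].
have mW : multiplier (fun x => (gamma * W x)%:C).
  rewrite (_ : (fun _ => _) = (fun x => gamma%:C * (W x)%:C)); last first.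
    by apply/funext => x; rewrite rmorphM.
  apply: multiplierM; first exact: multiplier_cst.
  by apply: exp_decay_multiplier A2; exact: cmeasurable_real.
have mN z : multiplier
    (fun x => - mu%:C - 2 * g%:C * `|Phi gamma x| ^+ 2 + z * (gamma * W x)%:C).
  under eq_fun do rewrite sqr_normc -mulNr.
  apply: multiplierD; first apply: multiplierD; first exact: multiplier_cst.
    apply: multiplierM; first exact: multiplier_cst.
    by apply: multiplierM => //; exact: multiplierJ.
  by apply: multiplierM => //; exact: multiplier_cst.
(* The values [z = i] and [z = - i] give the two diagonal entries. *)
have mV z : multiplier
    (fun x => z * (gamma * W x)%:C - mu%:C - 2 * g%:C * `|Phi gamma x| ^+ 2).
  rewrite [X in multiplier X](_ : _ = fun x => - mu%:C
    - 2 * g%:C * `|Phi gamma x| ^+ 2 + z * (gamma * W x)%:C) //.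
  by apply/funext => x; ring.
have mg m : multiplier m -> multiplier (fun x => - g%:C * m x ^+ 2).
  move=> mm; apply: multiplierM; first exact: multiplier_cst.
  by under eq_fun do rewrite expr2; exact: multiplierM.
have mb := mg _ mPhi; have mc := mg _ (multiplierJ _ mPhi).
have linL : linear_operator2 T by exact: linear_operator_matrix.
have linT := linear_isigma3 _ linL.
have [dv0 v0_neq0 _] := hv0; have ev0 := krein_eigenvector_isigma3 _ _ _ hv0.
rewrite adjoint_linearizationE in hv0s.
have [[dv1 dv2] v0s_neq0 _] := hv0s.
have Lv0 : L2x2 v0 by case: linL => Ld _ _; exact: Ld.
have Lv0s : L2x2 v0s by case: L2L => L _ _ _; split; [case: (L _ dv1) | case: (L _ dv2)].
have Lw := L2x2_sigma3 _ Lv0s.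
have adj u : dom T u ->
    inner2 (act (isigma3 T) u) (sigma3 v0s) = - conjc lambda0 * inner2 u (sigma3 v0s).
  by move=> [du1 du2]; exact: isigma3_adjoint.
split => [l0|l0|l0].
- by have [] := hPT l0; exact: krein_PT_real.
- apply: (simple_eigenvector_adjoint_neq0 (isigma3 T) lambda0) => //.
  + by case: hsimple.
  + move=> [z1 z2]; apply: v0s_neq0; split=> //.
    by apply: filterS z2 => x /= /(_ I) /eqP; rewrite oppr_eq0 => /eqP.
  (* On the imaginary axis [- conj(lambda0) = lambda0], so [sigma3 v0s] is an adjoint eigenvector in
     the sense of the abstract lemma. *)
  + move=> u /adj ->; congr (_ * _).
    case: lambda0 l0 {hlambda0 hsimple hsimples hv0 hv0s hPT ev0 adj} => a b.
    by move=> /= ->; simpc.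
have := adj _ dv0.
rewrite (inner2_ae _ (lin2 lambda0 v0 zero2) _ _ _ _ Lw Lw ev0 (aeq2_refl _)).
- rewrite inner2_lin2 ?inner2_0l ?addr0 //; last exact: L2x2_0.
  (* Taking [u = v0] gives [lambda0 K = - conj(lambda0) K]. The sum [lambda0 + conj(lambda0)] is
     twice the real part, which is nonzero here, so the factor [K] vanishes. *)
  move/eqP; rewrite mulNr -subr_eq0 opprK -mulrDl addcJ mulf_eq0 mulf_eq0.
  case/orP => [/orP[|]|/eqP//]; first by rewrite pnatr_eq0.
  by rewrite -(inj_eq (@complexI R)) in l0; rewrite (negbTE l0).
- by case: linT => _ La _; exact: La.
- by apply: L2x2_lin2 => //; exact: L2x2_0.
Qed.
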